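(* Let $a_1,\dots,a_k$ be positive integers, $N=a_1+\dots+a_k$, and let $P$ be the incomparable (disjoint) union of chains of lengths (numbers of elements) $a_1,\dots,a_k$. The solutions to a general Wronski system with constant weights for the chain polytope of $P$ are the factorizations of a univariate polynomial $f$ of degree $N$ into polynomials $f_1,\dots,f_k$, where $f_i$ has degree $a_i$. Precisely: introduce variables $x_{i,j}$ ($1\le i\le k$, $1\le j\le a_i$) and set $x_{i,0}:=1$. For real coefficients $(c_{l,j})_{1\le l\le N,\,0\le j\le N}$ outside some proper algebraic subset of the space of all such coefficients, there is a polynomial $f\in\mathbb{R}[z]$ of degree $N$ with $f(0)=1$ such that $$(x_{i,j})\longmapsto(f_1,\dots,f_k),\qquad f_i(z)=1+\sum_{j=1}^{a_i}x_{i,j}z^j,$$ is a bijection from the set of complex solutions of the system $$\sum_{\substack{0\le i_1\le a_1,\dots,0\le i_k\le a_k}} c_{l,\,i_1+\dots+i_k}\;x_{1,i_1}x_{2,i_2}\cdots x_{k,i_k}=0,\qquad l=1,\dots,N,$$ onto the set of $k$-tuples of complex polynomials $(f_1,\dots,f_k)$ with $f_i(0)=1$, $\deg f_i=a_i$ and $f_1f_2\cdots f_k=f$.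
   Context: The displayed system is the Wronski polynomial system, with all weights equal to $1$, for the canonical triangulation of the chain polytope of $P$. Here the variable $x_{i,j}$ is identified with an element of the $i$th chain, ordered $x_{i,1}>x_{i,2}>\dots>x_{i,a_i}$; antichains of $P$ correspond to the monomials $x_{1,i_1}\cdots x_{k,i_k}$, and the upper order ideal generated by such an antichain has $i_1+\dots+i_k$ elements. *)

(* Defs.v *)
From HB Require Import structures.
From mathcomp Require Import all_boot all_order all_algebra.
From mathcomp Require Import mpoly complex.
From mathcomp Require Import boolp classical_sets functions reals.

Set Implicit Arguments.
Unset Strict Implicit.
Unset Printing Implicit Defensive.

Import GRing.Theory.

Local Open Scope classical_set_scope.
Local Open Scope ring_scope.
Local Open Scope complex_scope.

(* Matrices are viewed as points of affine m*n-space through [mxvec]. *)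
Definition algebraic_subset (R : comNzRingType) (m n : nat)
    (Z : set 'M[R]_(m, n)) : Prop :=
  exists S : seq {mpoly R[m * n]},
    Z = [set A | forall p, p \in S -> p.@[mxvec A 0] = 0].

Definition poset_size (k : nat) (a : 'I_k -> nat) : nat := (\sum_(i < k) a i)%N.

(* The underlying set of the disjoint union P of the chains; [Tagged _ j] in  *)
(* the i-th chain, with j : 'I_(a i) counted from 0, carries x_{i,j+1}.       *)
Definition chain_elt (k : nat) (a : 'I_k -> nat) : finType :=
  {i : 'I_k & 'I_(a i)}.

(* The tuples (i_1, ..., i_k) with 0 <= i_m <= a_m; these encode the           *)
(* antichains of P.                                                            *)
Definition multi_index (k : nat) (a : 'I_k -> nat) : finType :=
  {dffun forall i : 'I_k, 'I_(a i).+1}.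

Lemma ideal_size_subproof (k : nat) (a : 'I_k -> nat) (s : multi_index a) :
  (\sum_(i < k) s i < (poset_size a).+1)%N.
Proof. by rewrite ltnS; apply: leq_sum => i _; rewrite -ltnS. Qed.

(* The number i_1 + ... + i_k of elements of the upper order ideal generated  *)
(* by the antichain x_{1,i_1}, ..., x_{k,i_k} (where i_m = 0 means that no     *)
(* element of the m-th chain is taken); it indexes the columns of c below.     *)
Definition ideal_size (k : nat) (a : 'I_k -> nat) (s : multi_index a) :
    'I_(poset_size a).+1 :=
  Ordinal (ideal_size_subproof s).

(* x_{i,j} for 0 <= j <= a_i, with x_{i,0} = 1. *)
Definition coord (C : nzRingType) (k : nat) (a : 'I_k -> nat)
    (x : {ffun chain_elt a -> C}) (i : 'I_k) (j : 'I_(a i).+1) : C :=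
  if unlift ord0 j is Some j' then x (Tagged (fun i => 'I_(a i)) j') else 1.

(* Row l of c holds the coefficients c_{l,0}, ..., c_{l,N} of one equation. *)
Definition wronski_solutions (R : rcfType) (k : nat) (a : 'I_k -> nat)
    (c : 'M[R]_(poset_size a, (poset_size a).+1)) :
    set {ffun chain_elt a -> R[i]} :=
  [set x | forall l : 'I_(poset_size a),
    \sum_(s : multi_index a)
      (c l (ideal_size s))%:C * \prod_(i < k) coord x (s i) = 0].

Definition chain_poly (C : nzRingType) (k : nat) (a : 'I_k -> nat)
    (x : {ffun chain_elt a -> C}) : {ffun 'I_k -> {poly C}} :=
  [ffun i => 1 + \sum_(j < a i) x (Tagged (fun i => 'I_(a i)) j) *: 'X^(j.+1)].

Definition factorizations (R : rcfType) (k : nat) (a : 'I_k -> nat)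
    (f : {poly R}) : set {ffun 'I_k -> {poly R[i]}} :=
  [set g | [/\ forall i, (g i).[0] = 1,
               forall i, size (g i) = (a i).+1 &
               \prod_(i < k) g i = map_poly (real_complex R) f]].

(* Main.v *)
(* The system reads c y = 0, where y is the coefficient vector of the product
   f_1 ... f_k and y_0 = 1. If the minor of c without its column 0 is nonzero,
   this linear system has exactly one solution y with y_0 = 1, the coefficient
   vector of f. If moreover the minor without the last column is nonzero, then
   y_N <> 0, so that f has degree N, which forces deg f_i = a_i for every i. *)

Require Import Defs.
From HB Require Import structures.
From mathcomp Require Import all_boot all_order all_algebra.
From mathcomp Require Import mpoly complex.
From mathcomp Require Import boolp classical_sets functions reals.

Set Implicit Arguments.
Unset Strict Implicit.
Unset Printing Implicit Defensive.

Import GRing.Theory.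

Local Open Scope classical_set_scope.
Local Open Scope ring_scope.

(** [bigA_distr_big_dep] distributes over functions with a single codomain, so the types [T i] are
    first merged into their tagged sum; the functions choosing tag [i] at each [i] are then read
    back as dependent functions. *)
Lemma prod_sum_dffun (R : comPzSemiRingType) (I : finType) (T : I -> finType)
    (F : forall i, T i -> R) :
  \prod_i \sum_(j : T i) F i j =
  \sum_(s : {dffun forall i, T i}) \prod_i F i (s i).
Proof.
under eq_bigr do rewrite big_tag.
rewrite (bigA_distr_big_dep (fun i => tagged_with T i)).
have -> : \sum_(s : {dffun forall i, T i}) \prod_i F i (s i) =
    \sum_(t : fprod T) \prod_i finfun (F i) (t i).
  rewrite (reindex (@dffun_of_fprod I T)) /=; last first.
    exact/onW_bij/dffun_of_fprod_bij.
  by apply: eq_bigr => t _; apply: eq_bigr => i _; rewrite !ffunE.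
rewrite big_fprod; apply: eq_bigr => g /familyP gT; apply: eq_bigr => i _.
have e : tag (g i) = i by apply/eqP; have := gT i; rewrite inE.
by rewrite !(untagE _ _ e) ffunE.
Qed.

(** Degrees of nonzero polynomials over a domain add up, and a sum of bounded terms reaches the sum
    of the bounds only if each term reaches its own. *)
Lemma size_prod_factors (R : idomainType) (I : finType) (a : I -> nat)
    (F : I -> {poly R}) :
    (forall i, size (F i) <= (a i).+1)%N ->
    size (\prod_i F i) = (\sum_i a i).+1 ->
  forall i, size (F i) = (a i).+1.
Proof.
move=> leF szF.
have F0 i : F i != 0.
  have : \prod_i F i != 0 by rewrite -size_poly_gt0 szF.
  by move/prodf_neq0/(_ i isT).
have sz_gt0 i : (0 < size (F i))%N by rewrite size_poly_gt0.
have le_pred i : true -> ((size (F i)).-1 <= a i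
    ?= iff ((size (F i)).-1 == a i))%N.
  by move=> _; split=> //; rewrite -ltnS prednK.
have [_] := leqif_sum le_pred.
suff -> : (\sum_i (size (F i)).-1 = \sum_i a i)%N.
  by rewrite eqxx => /esym/forallP eqa i; rewrite -(eqP (eqa i)) prednK.
move: szF; rewrite size_prod //.
(* Each size exceeds the degree by one, hence the correction by [#|I|]. *)
have -> : (\sum_i size (F i) = \sum_i (size (F i)).-1 + #|I|)%N.
  rewrite -sum1_card -big_split /=; apply: eq_bigr => i _.
  by rewrite addn1 prednK.
by rewrite -addSn addnK => -[].
Qed.

(** When entry [j] of [w] vanishes, deleting it leaves a square invertible system. This gives
    uniqueness of a kernel vector with prescribed entry [j], and shows that a nonzero kernel vector
    has a nonzero entry [j]. *)
Lemma unitmx_col'_inj (F : fieldType) (n : nat) (A : 'M[F]_(n, n.+1)) j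
    (w : 'cV[F]_n.+1) :
  col' j A \in unitmx -> A *m w = 0 -> w j 0 = 0 -> w = 0.
Proof.
move=> Au Aw wj.
have Aw' : col' j A *m row' j w = 0.
  rewrite -Aw; apply/matrixP=> i l; rewrite (ord1 l) !mxE (bigD1_ord j) //=.
  by rewrite wj mulr0 add0r; apply: eq_bigr => m _; rewrite !mxE.
have w'0 : row' j w = 0 by rewrite -(mulKmx Au (row' j w)) Aw' mulmx0.
apply/matrixP=> i l; rewrite (ord1 l) [RHS]mxE.
case: (unliftP j i) => [i'|] -> //.
by move/matrixP: w'0 => /(_ i' 0); rewrite !mxE.
Qed.

Lemma wide_kernel (F : fieldType) (m n : nat) (A : 'M[F]_(m, n)) :
  (m < n)%N -> exists2 w : 'cV[F]_n, A *m w = 0 & w != 0.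
Proof.
move=> mn.
(* The [n] rows of [A^T] span a space of dimension at most [m < n], so they are dependent. *)
have : kermx A^T != 0.
  rewrite kermx_eq0 /row_free mxrank_tr neq_ltn.
  by rewrite (leq_ltn_trans (rank_leq_row A)).
case/rowV0Pn=> v /sub_kermxP vA v0; exists v^T; last by rewrite trmx_eq0.
by rewrite -[A]trmxK -trmx_mul vA trmx0.
Qed.

Definition coef_col (R : nzSemiRingType) (n : nat) (p : {poly R}) : 'cV[R]_n :=
  \col_i p`_i.

Lemma coef_col_inj (R : nzRingType) (n : nat) (p q : {poly R}) :
    (size p <= n)%N -> (size q <= n)%N ->
  coef_col n p = coef_col n q -> p = q.
Proof.
move=> szp szq epq; apply/polyP=> i; case: (ltnP i n) => [lt_in|le_ni].
  by move/matrixP: epq => /(_ (Ordinal lt_in) 0); rewrite !mxE.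
by rewrite !nth_default // (leq_trans _ le_ni).
Qed.

Section ChainPoly.

Variables (C : comNzRingType) (k : nat) (a : 'I_k -> nat).
Implicit Types x : {ffun chain_elt a -> C}.

Lemma chain_polyE x i :
  chain_poly x i = \sum_(j < (a i).+1) Defs.coord x j *: 'X^j.
Proof.
rewrite ffunE big_ord_recl /Defs.coord unlift_none scale1r; congr (_ + _).
by apply: eq_bigr => j _; rewrite liftK.
Qed.

Lemma coef_chain_poly x i (j : 'I_(a i).+1) :
  (chain_poly x i)`_j = Defs.coord x j.
Proof.
rewrite chain_polyE coef_sum (bigD1 j) //= coefZ coefXn eqxx mulr1.
rewrite big1 ?addr0 // => l; rewrite eq_sym => ljN.
by rewrite coefZ coefXn (inj_eq val_inj) (negbTE ljN) mulr0.
Qed.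

Lemma size_chain_poly x i : (size (chain_poly x i) <= (a i).+1)%N.
Proof.
rewrite chain_polyE; apply: (leq_trans (size_sum _ _ _)).
apply/bigmax_leqP => j _; apply: (leq_trans (size_scale_leq _ _)).
by rewrite size_polyXn.
Qed.

Lemma chain_poly0 x i : (chain_poly x i).[0] = 1.
Proof.
by rewrite horner_coef0 (coef_chain_poly x ord0) /Defs.coord unlift_none.
Qed.

Lemma chain_poly_inj : injective (@chain_poly C k a).
Proof.
move=> x y exy; apply/ffunP=> -[i j].
have := congr1 (fun f : {ffun 'I_k -> {poly C}} => (f i)`_(lift ord0 j)) exy.
by rewrite !coef_chain_poly /Defs.coord liftK.
Qed.

Lemma chain_poly_surj (g : {ffun 'I_k -> {poly C}}) :
    (forall i, (g i).[0] = 1) -> (forall i, size (g i) <= (a i).+1)%N ->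
  exists x, chain_poly x = g.
Proof.
move=> g0 szg.
(* Positions in a chain count from 0, so position [j] takes the coefficient of degree [j + 1];
   degree 0 is covered by [g0]. *)
exists [ffun e : chain_elt a => (g (tag e))`_((tagged e : nat).+1)].
apply/ffunP=> i.
apply: (coef_col_inj (size_chain_poly _ i) (szg i)).
apply/matrixP=> j l; rewrite !mxE coef_chain_poly /Defs.coord.
by case: unliftP => [j'|] ->; rewrite ?ffunE // -horner_coef0 g0.
Qed.

Lemma prod_chain_poly x :
  \prod_i chain_poly x i =
  \sum_(s : multi_index a) (\prod_i Defs.coord x (s i)) *: 'X^(ideal_size s).
Proof.
under eq_bigr => i _ do rewrite chain_polyE.
rewrite prod_sum_dffun; apply: eq_bigr => s _.
by rewrite scaler_prod -expr_sum.
Qed.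

Lemma size_prod_chain_poly x :
  (size (\prod_i chain_poly x i)%R <= (poset_size a).+1)%N.
Proof.
rewrite prod_chain_poly; apply: (leq_trans (size_sum _ _ _)).
apply/bigmax_leqP => s _; apply: (leq_trans (size_scale_leq _ _)).
by rewrite size_polyXn.
Qed.

(** The coefficient of a monomial depends only on its ideal size, which by [prod_chain_poly] is the
    degree where the monomial enters the product. Grouping by degree makes the equation linear in
    the coefficients of the product. *)
Lemma wronski_sumE x (m : nat) (c : 'M[C]_(m, (poset_size a).+1)) l :
  \sum_(s : multi_index a) c l (ideal_size s) * \prod_i Defs.coord x (s i) =
  (c *m coef_col _ (\prod_i chain_poly x i)) l 0.
Proof.
rewrite mxE; under [RHS]eq_bigr do
  rewrite mxE prod_chain_poly coef_sum mulr_sumr.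
rewrite exchange_big; apply: eq_bigr => s _ /=.
rewrite (bigD1 (ideal_size s)) //= coefZ coefXn eqxx mulr1.
rewrite [X in _ + X]big1 ?addr0 // => j jN.
have /negbTE jF : j != ideal_size s :> nat by [].
by rewrite coefZ coefXn jF !mulr0.
Qed.

End ChainPoly.

Lemma wronski_solutionsE (R : rcfType) (k : nat) (a : 'I_k -> nat)
    (c : 'M[R]_(poset_size a, (poset_size a).+1))
    (x : {ffun chain_elt a -> R[i]}) :
  wronski_solutions c x <->
  map_mx (real_complex R) c *m coef_col _ (\prod_i chain_poly x i) = 0.
Proof.
have eqE l : \sum_(s : multi_index a)
      ((c l (ideal_size s))%:C)%C * \prod_(i < k) Defs.coord x (s i) =
    (map_mx (real_complex R) c *m coef_col _ (\prod_i chain_poly x i)) l 0.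
  by rewrite -wronski_sumE; apply: eq_bigr => s _; rewrite mxE.
split=> [sol|cw0 l]; last by rewrite eqE cw0 mxE.
by apply/matrixP=> l j; rewrite (ord1 j) -eqE sol mxE.
Qed.

Lemma algebraic_subset_det_col' (R : comNzRingType) (n : nat)
    (js : seq 'I_n.+1) :
  algebraic_subset
    [set A : 'M[R]_(n, n.+1) | \prod_(j <- js) \det (col' j A) = 0].
Proof.
(* [X] is the generic matrix; evaluation is a ring morphism, so it sends the minors of [X] to those
   of [A]. *)
pose X : 'M[{mpoly R[n * n.+1]}]_(n, n.+1) :=
  \matrix_(i, j) 'X_(mxvec_index i j).
exists [:: \prod_(j <- js) \det (col' j X)].
have evalX A : (\prod_(j <- js) \det (col' j X)).@[mxvec A 0] =
    \prod_(j <- js) \det (col' j A).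
  rewrite rmorph_prod; apply: eq_bigr => j _ /=; rewrite -det_map_mx.
  congr (\det _); apply/matrixP=> i l; rewrite !mxE /=.
  by rewrite mevalXU mxvecE.
apply/seteqP; split=> A /= => [A0 p|/(_ _ (mem_head _ _))].
  by rewrite inE => /eqP ->; rewrite evalX.
by rewrite evalX.
Qed.

(* The witness is bidiagonal, so that both minors are triangular with unit
   diagonal. *)
Lemma exists_col'_dets (R : comNzRingType) (n : nat) :
  exists A : 'M[R]_(n, n.+1),
    \det (col' ord0 A) = 1 /\ \det (col' ord_max A) = 1.
Proof.
exists (\matrix_(i, j) ((j == i :> nat) || (j == i.+1 :> nat))%:R).
split.
  rewrite det_trig ?big1 // => [i _|].
    by rewrite !mxE lift0 eqxx orbT.
  apply/is_trig_mxP=> i j ij; rewrite !mxE lift0 eqSS.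
  by rewrite !gtn_eqF ?(leq_trans ij).
(* Without its last column the witness is upper triangular, while [det_trig] expects lower
   triangular. *)
rewrite -det_tr det_trig ?big1 // => [i _|].
  by rewrite !mxE lift_max eqxx.
apply/is_trig_mxP=> i j ij; rewrite !mxE lift_max.
by rewrite !ltn_eqF ?(leq_trans ij).
Qed.

(** A nonzero kernel vector exists because columns outnumber rows. The two minors make its first and
    last entries nonzero: the first allows scaling to constant term 1, the last gives the exact
    degree. *)
Lemma exists_kernel_poly (F : fieldType) (n : nat) (A : 'M[F]_(n, n.+1)) :
    col' ord0 A \in unitmx -> col' ord_max A \in unitmx ->
  exists f : {poly F},
    [/\ size f = n.+1, f.[0] = 1 & A *m coef_col n.+1 f = 0].
Proof.
move=> A0 Amax; have [w Aw w0] := wide_kernel A (ltnSn n).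
have wN0 j : col' j A \in unitmx -> w j 0 != 0.
  by move=> Aj; apply: contra_neq w0; exact: unitmx_col'_inj Aj Aw.
pose u := (w ord0 0)^-1 *: w.
have fE : coef_col n.+1 (\poly_(i < n.+1) u (inord i) 0) = u.
  by apply/matrixP=> i j; rewrite (ord1 j) mxE coef_poly ltn_ord inord_val.
exists (\poly_(i < n.+1) u (inord i) 0); split.
- apply: size_poly_eq; rewrite mxE mulf_neq0 ?invr_neq0 ?wN0 //.
  by rewrite (_ : inord n = ord_max) ?wN0 //; apply/val_inj; rewrite /= inordK.
- rewrite horner_coef0 coef_poly /= mxE.
  rewrite (_ : inord 0 = ord0) ?mulVf ?wN0 //.
  by apply/val_inj; rewrite /= inordK.
- by rewrite fE -scalemxAr Aw scaler0.
Qed.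

Theorem theorem7p4 (R : realType) (k : nat) (a : 'I_k -> nat)
    (a_gt0 : forall i, (0 < a i)%N) :
  exists Z : set 'M[R]_(poset_size a, (poset_size a).+1),
    [/\ algebraic_subset Z,
        Z `<` setT &
        forall c, ~ Z c ->
          exists f : {poly R},
            [/\ size f = (poset_size a).+1,
                f.[0] = 1 &
                set_bij (wronski_solutions c) (factorizations a f)
                        (@chain_poly R[i] k a)]].
Proof.
exists [set A | \prod_(j <- [:: ord0; ord_max]) \det (col' j A) = 0].
split; first exact: algebraic_subset_det_col'.
  split=> // sub; have [A [A0 Amax]] := exists_col'_dets R (poset_size a).
  have /= := sub A I; rewrite !big_cons big_nil A0 Amax !mulr1.
  by apply/eqP; exact: oner_neq0.
move=> c /= /eqP; rewrite !big_cons big_nil mulr1 mulf_eq0 negb_or.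
rewrite -!unitfE -!unitmxE => /andP[c0 cmax].
have [f [szf f0 cf]] := exists_kernel_poly c0 cmax.
exists f; split=> //.
pose fC := map_poly (real_complex R) f.
have szfC : size fC = (poset_size a).+1 by rewrite size_map_poly.
have cfC : map_mx (real_complex R) c *m coef_col _ fC = 0.
  have -> : coef_col (poset_size a).+1 fC =
      map_mx (real_complex R) (coef_col _ f).
    by apply/matrixP=> i j; rewrite !mxE coef_map.
  by rewrite -map_mxM cf map_mx0.
split.
- move=> x /wronski_solutionsE cx.
  have prodE : \prod_i chain_poly x i = fC.
    apply: (coef_col_inj (size_prod_chain_poly x)); first by rewrite szfC.
    (* The difference of the two coefficient vectors lies in the kernel, and its entry 0 vanishes
       since both constant terms are 1. *)
    apply/eqP; rewrite -subr_eq0; apply/eqP.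
    apply: (@unitmx_col'_inj _ _ (map_mx (real_complex R) c) ord0).
    + by rewrite -map_col' map_unitmx.
    + by rewrite mulmxBr cx cfC subrr.
    rewrite !mxE coef_map /= -!horner_coef0 f0 horner_prod.
    by rewrite big1 ?rmorph1 ?subrr // => i _; exact: chain_poly0.
  split=> // [i|]; first exact: chain_poly0.
  by apply: size_prod_factors; [exact: size_chain_poly | rewrite prodE].
- by move=> x y _ _; exact: chain_poly_inj.
(* Any factorization comes from some [x]; the product is then [fC], whose coefficient vector is in
   the kernel by [cfC], so [x] is a solution. *)
move=> g [g0 szg prodg].
have [|x xg] := chain_poly_surj g0 (a := a); first by move=> i; rewrite szg.
exists x => //; apply/wronski_solutionsE.
by rewrite xg prodg.
Qed.
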